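(* Let $a\in-\mathbb N$ (i.e. $-a\in\{0,1,2,\dots\}$) and let $r=q^a$. Then the polynomials $w_m(x),v_n(x)\in\mathcal M[x]$ and $w_{m,n}(x,y)\in\mathcal M[x,y]$ satisfy $$\sum_{n=0}^{1-a}(-1)^n\begin{bmatrix}1-a\\ n\end{bmatrix}_qw_{1-a-n,n}(x,y)=\sum_{n=0}^{1-a}(-1)^n\begin{bmatrix}1-a\\ n\end{bmatrix}_qw_{1-a-n}(x)\,v_n(y)=\sum_{n=0}^{1-a}(-1)^n\begin{bmatrix}1-a\\ n\end{bmatrix}_qv_{1-a-n}(x)\,w_n(y).$$
   Context: $k$ is a field of characteristic $0$, $\mathbb K=k(q)$, $\mathcal M$ is an associative $\mathbb K$-algebra, $\mathcal M[x]=\mathcal M\otimes_{\mathbb K}\mathbb K[x]$, $\mathcal M[x,y]=\mathcal M\otimes_{\mathbb K}\mathbb K[x,y]$. Fix a nonzero element of $\mathcal M$ denoted $b^2$, and let $b$ be a formal square root of it. $[n]_q=\frac{q^n-q^{-n}}{q-q^{-1}}$, with symmetric quantum factorials $[n]_q^!$ and binomials. The continuous $q$-Hermite polynomials are given by $H_m=0$ for $m<0$, $H_0(x;q)=1$, $2xH_m(x;q)=H_{m+1}(x;q)+(1-q^m)H_{m-1}(x;q)$. The bivariate continuous $q$-Hermite polynomials $H_{m,n}(x,y;q,r)$ are given by $H_{0,n}(x,y;q,r)=H_n(y;q)$, $H_{m,n}=0$ if $m<0$ or $n<0$, and $2xH_{m,n}=H_{m+1,n}+(1-q^m)H_{m-1,n}+q^m(1-q^n)r\,H_{m,n-1}$.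 Define $w_m(x)=(b/2)^mH_m(x/b;q^2)$ and $w_{m,n}(x,y)=(b/2)^{m+n}H_{m,n}(x/b,y/b;q^2,r)$; only even powers of $b$ occur, so these lie in $\mathcal M[x]$, $\mathcal M[x,y]$. Equivalently $w_0=1$, $w_1=x$, $xw_m=w_{m+1}+\frac{b^2}{4}(1-q^{2m})w_{m-1}$; and $w_{0,n}(x,y)=w_n(y)$, $xw_{m,n}=w_{m+1,n}+\frac{b^2}4(1-q^{2m})w_{m-1,n}+\frac{b^2}4q^{2m}(1-q^{2n})r\,w_{m,n-1}$ (terms with a negative index are $0$). Finally $$v_m(x)=\sum_{k=0}^{\lfloor m/2\rfloor}(-1)^kq^k\eta(k)\frac{[m]_q^!}{[m-2k]_q^!\,[k]_q^!}\,w_{m-2k}(x),\qquad\eta(k)=(q-q^{-1})^kq^{-k(k+1)/2}(b^2/4)^k.$$ *)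

(* Defs.v *)
From HB Require Import structures.
From mathcomp Require Import all_boot all_order all_algebra.
From mathcomp Require Import zify ring.

Set Implicit Arguments.
Unset Strict Implicit.
Unset Printing Implicit Defensive.

Import GRing.Theory.
Local Open Scope ring_scope.

Section QNumbers.
Variables (F : fieldType) (q : F).

(* Symmetric q-numbers; q is meant to be nonzero and not a root of unity. *)
Definition qnum (n : nat) : F := (q ^+ n - q ^- n) / (q - q^-1).
Definition qfact (n : nat) : F := \prod_(1 <= i < n.+1) qnum i.
Definition qbinom (n m : nat) : F := qfact n / (qfact m * qfact (n - m)).

End QNumbers.

Section QHermite.
Variables (F : fieldType) (q r : F).

Fixpoint qHermite (m : nat) : {poly F} :=
  if m isn't m'.+1 then 1 else
  2%:R *: ('X * qHermite m')
  - (1 - q ^+ m') *: (if m' is m''.+1 then qHermite m'' else 0).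

(* Bivariate polynomials are elements of {poly {poly F}}, with x the outer
   indeterminate 'X and y the inner one 'Y = 'X%:P. *)
Fixpoint qHermite2 (m n : nat) : {poly {poly F}} :=
  if m isn't m'.+1 then (qHermite n)%:P else
  2%:R *: ('X * qHermite2 m' n)
  - (1 - q ^+ m')%:P *: (if m' is m''.+1 then qHermite2 m'' n else 0)
  - (q ^+ m' * (1 - q ^+ n) * r)%:P *:
      (if n is n'.+1 then qHermite2 m' n' else 0).

Lemma qHermite_gt m i : (m < i)%N -> (qHermite m)`_i = 0.
Proof.
elim/ltn_ind: m i => -[|m] IH i lt_mi /=; first by rewrite coef1 gtn_eqF.
case: i lt_mi => // i lt_mi.
rewrite coefB !coefZ coefXM /= IH // mulr0 sub0r.
case: m IH lt_mi => [|m] IH lt_mi; first by rewrite coef0 mulr0 oppr0.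
by rewrite IH ?mulr0 ?oppr0 //; lia.
Qed.

Lemma qHermite_odd m i : odd (m + i) -> (qHermite m)`_i = 0.
Proof.
elim/ltn_ind: m i => -[|m] IH i /=; first by case: i => //= i; rewrite coef1.
move=> odd_mi; rewrite coefB !coefZ coefXM.
have -> : (if i == 0 then 0 else (qHermite m)`_i.-1) = 0.
  by case: i odd_mi => // i odd_mi; rewrite IH //; lia.
rewrite mulr0 sub0r; case: m IH odd_mi => [|m] IH odd_mi.
  by rewrite coef0 mulr0 oppr0.
by rewrite IH ?mulr0 ?oppr0 //; lia.
Qed.

Lemma coef_qHermite2S m n i j : (qHermite2 m.+1 n)`_i`_j =
  2%:R * (if i is i'.+1 then (qHermite2 m n)`_i'`_j else 0)
  - (1 - q ^+ m) * (if m is m'.+1 then (qHermite2 m' n)`_i`_j else 0)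
  - q ^+ m * (1 - q ^+ n) * r *
      (if n is n'.+1 then (qHermite2 m n')`_i`_j else 0).
Proof.
rewrite /= !coefB !coefZ coefXM !coefCM -polyC_natr coefCM.
by case: i m n => [|i] [|m] [|n]; rewrite ?coef0.
Qed.

Lemma qHermite2_gt m n i j : (m + n < i + j)%N -> (qHermite2 m n)`_i`_j = 0.
Proof.
elim/ltn_ind: m n i j => -[|m] IH n i j lt_mi.
  rewrite coefC; case: eqP lt_mi => [->|_ _]; last by rewrite coef0.
  by exact: qHermite_gt.
rewrite coef_qHermite2S.
case: i lt_mi => [|i] lt_mi; case: m IH lt_mi => [|m] IH lt_mi;
  case: n lt_mi => [|n] lt_mi; rewrite ?IH ?mulr0 ?subr0 //; lia.
Qed.

Lemma qHermite2_odd m n i j :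
  odd (m + n + i + j) -> (qHermite2 m n)`_i`_j = 0.
Proof.
elim/ltn_ind: m n i j => -[|m] IH n i j odd_mi.
  rewrite coefC; case: eqP odd_mi => [->|_ _]; last by rewrite coef0.
  by rewrite addn0; exact: qHermite_odd.
rewrite coef_qHermite2S.
case: i odd_mi => [|i] odd_mi; case: m IH odd_mi => [|m] IH odd_mi;
  case: n odd_mi => [|n] odd_mi; rewrite ?IH ?mulr0 ?subr0 //; lia.
Qed.

End QHermite.

Section Rescaling.
Variables (F : fieldType) (A : algType F) (b2 : A).

(* bscale d p is (b/2)^d p(x/b), where b is a formal square root of b2 and p is
   a polynomial of degree at most d whose monomials all have degree congruent to
   d modulo 2: the coefficient of x^i carries b^(d-i) = b2^((d-i)/2). *)
Definition bscale (d : nat) (p : {poly F}) : {poly A} :=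
  \poly_(i < size p) ((p`_i / 2%:R ^+ d) *: b2 ^+ (d - i)./2).

(* Likewise (b/2)^d p(x/b,y/b), with total degrees. *)
Definition bscale2 (d : nat) (p : {poly {poly F}}) : {poly {poly A}} :=
  \poly_(i < size p) \poly_(j < size p`_i)
    ((p`_i`_j / 2%:R ^+ d) *: b2 ^+ (d - (i + j))./2).

Lemma coef_bscale d p i :
  (bscale d p)`_i = (p`_i / 2%:R ^+ d) *: b2 ^+ (d - i)./2.
Proof.
rewrite coef_poly; case: ltnP => // le_pi.
by rewrite nth_default // mul0r scale0r.
Qed.

Lemma coef_bscale2 d p i j :
  (bscale2 d p)`_i`_j = (p`_i`_j / 2%:R ^+ d) *: b2 ^+ (d - (i + j))./2.
Proof.
rewrite coef_poly; case: ltnP => [_|le_pi]; last first.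
  by rewrite [p`_i]nth_default // !coef0 mul0r scale0r.
rewrite coef_poly; case: ltnP => // le_pj.
by rewrite [p`_i`_j]nth_default // mul0r scale0r.
Qed.

Variables (q r : F).

Definition w (m : nat) : {poly A} := bscale m (qHermite (q ^+ 2) m).

Definition w2 (m n : nat) : {poly {poly A}} :=
  bscale2 (m + n) (qHermite2 (q ^+ 2) r m n).

Definition eta (k : nat) : A :=
  ((q - q^-1) ^+ k * q ^- (k * k.+1)./2) *: (4%:R^-1 *: b2) ^+ k.

Definition v (m : nat) : {poly A} :=
  \sum_(0 <= k < m./2.+1)
    (((-1) ^+ k * q ^+ k * (qfact q m / (qfact q (m - k.*2) * qfact q k)))
       *: eta k) *: w (m - k.*2).

Lemma w_0 : w 0 = 1.
Proof.
apply/polyP => i; rewrite coef_bscale /= expr0 divr1 !coef1.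
by case: i => [|i]; rewrite ?scale1r ?scale0r.
Qed.

Lemma w2_0 n : w2 0 n = (w n)%:P.
Proof.
apply/polyP => i; apply/polyP => j; rewrite coef_bscale2 /= !coefC.
case: eqP => [->|_]; first by rewrite coef_bscale !add0n.
by rewrite !coef0 mul0r scale0r.
Qed.

Hypothesis two_neq0 : 2%:R != 0 :> F.

Lemma scale_step (c g : F) d e : ((d < e)%N -> g = 0) ->
  ((c / 4%:R) *: b2) * ((g / 2%:R ^+ d) *: b2 ^+ (d - e)./2) =
  (c * g / 2%:R ^+ d.+1 / 2%:R) *: b2 ^+ (d.+2 - e)./2.
Proof.
have n4 : 4%:R = 2%:R * 2%:R :> F by rewrite -natrM.
have [_ ->|le_ed _] := ltnP d e; rewrite ?(mul0r, mulr0, scale0r) //.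
rewrite -scalerAl -scalerAr scalerA -exprS.
congr (_ *: _ ^+ _); last by rewrite !subSn //= ltnW.
by rewrite exprS; field; rewrite n4 mulf_neq0 ?two_neq0 ?expf_neq0.
Qed.

Lemma w_rec m : 'X * w m =
  w m.+1 + (((1 - q ^+ (2 * m)) / 4%:R) *: b2) *:
             (if m is m'.+1 then w m' else 0).
Proof.
apply/polyP => i; rewrite coefXM coefD coefZ (coef_bscale m.+1) /=.
rewrite coefB !coefZ coefXM -exprM.
have -> : (if i == 0%N then 0 else (w m)`_i.-1) =
  ((if i == 0%N then 0 else (qHermite (q ^+ 2) m)`_i.-1) / 2%:R ^+ m)
    *: b2 ^+ (m.+1 - i)./2.
  by case: i => [|i] /=; rewrite ?mul0r ?scale0r // coef_bscale subSS.
set h := (if _ then _ else _).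
rewrite [X in _ = _ + X](_ : _ =
  ((1 - q ^+ (2 * m)) *
    (if m is m'.+1 then qHermite (q ^+ 2) m' else 0 : {poly F})`_i
      / 2%:R ^+ m / 2%:R)
    *: b2 ^+ (m.+1 - i)./2); last first.
  case: m {h} => [|m]; first by rewrite !coef0 !(mulr0, mul0r) scale0r.
  by rewrite coef_bscale scale_step //; exact: qHermite_gt.
rewrite -scalerDl; congr (_ *: _).
set g := (X in _ - _ * X); set g' := (X in _ + _ * X / _ / _).
have -> : g' = g by rewrite /g' /g; case: (m).
by rewrite exprS; field; rewrite two_neq0 ?expf_neq0.
Qed.

Lemma w_1 : w 1 = 'X.
Proof. by have := w_rec 0; rewrite w_0 mulr1 scaler0 addr0. Qed.

Lemma w2_rec m n : 'X * w2 m n =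
  w2 m.+1 n
  + (((1 - q ^+ (2 * m)) / 4%:R) *: b2)%:P *:
      (if m is m'.+1 then w2 m' n else 0)
  + ((q ^+ (2 * m) * (1 - q ^+ (2 * n)) * r / 4%:R) *: b2)%:P *:
      (if n is n'.+1 then w2 m n' else 0).
Proof.
apply/polyP => i; apply/polyP => j.
rewrite coefXM !coefD !coefZ !coefCM (coef_bscale2 (m.+1 + n)).
rewrite coef_qHermite2S -!exprM.
have -> : (if i == 0%N then 0 else (w2 m n)`_i.-1 : {poly A})`_j =
  ((if i is i'.+1 then (qHermite2 (q ^+ 2) r m n)`_i'`_j else 0)
      / 2%:R ^+ (m + n)) *: b2 ^+ ((m + n).+1 - (i + j))./2.
  by case: i => [|i] /=; rewrite ?coef0 ?mul0r ?scale0r // coef_bscale2 subSS.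
rewrite [X in _ = _ + X + _](_ : _ =
  ((1 - q ^+ (2 * m)) *
    (if m is m'.+1 then (qHermite2 (q ^+ 2) r m' n)`_i`_j else 0)
      / 2%:R ^+ (m + n) / 2%:R) *: b2 ^+ ((m + n).+1 - (i + j))./2); last first.
  case: m => [|m]; first by rewrite !coef0 !(mulr0, mul0r) scale0r.
  by rewrite coef_bscale2 scale_step //; exact: qHermite2_gt.
rewrite [X in _ = _ + _ + X](_ : _ =
  (q ^+ (2 * m) * (1 - q ^+ (2 * n)) * r *
    (if n is n'.+1 then (qHermite2 (q ^+ 2) r m n')`_i`_j else 0)
      / 2%:R ^+ (m + n) / 2%:R) *: b2 ^+ ((m + n).+1 - (i + j))./2); last first.
  case: n => [|n]; first by rewrite !coef0 !(mulr0, mul0r) scale0r.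
  by rewrite coef_bscale2 scale_step ?addnS //; exact: qHermite2_gt.
rewrite addSn -!scalerDl; congr (_ *: _).
set f := (X in _ = (2%:R * X - _ - _) / _ + _ + _).
set g := (X in _ = (_ - _ * X - _) / _ + _ + _).
set h := (X in _ = (_ - _ * X) / _ + _ + _).
set f' := (X in X / _ = _).
set g' := (X in _ = _ + _ * X / _ / _ + _).
set h' := (X in _ = _ + _ * X / _ / _).
have -> : f' = f by rewrite /f' /f; case: (i).
have -> : g' = g by rewrite /g' /g; case: (m).
have -> : h' = h by rewrite /h' /h; case: (n).
by rewrite exprS; field; rewrite two_neq0 ?expf_neq0.
Qed.

End Rescaling.

(* Main.v *)
Require Import Defs.
From mathcomp Require Import all_boot all_order all_algebra.
From mathcomp Require Import zify ring.
Import GRing.Theory.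
Local Open Scope ring_scope.

(** Each of the three sums can be expanded in the products
    (b^2/4)^k w_s(x) w_t(y) with 2k + s + t = N, where N = 1 - a, and the three
    expansions have the same scalar coefficient, namely, with T = k(k+1)/2,

      (-1)^(t+k) [N]! / ([k]! [s]! [t]!) (q - q^-1)^k q^(k-T).

    For the two sums built from v this is a reindexing of the definition of v:
    the q-binomial coefficient and the quotient of factorials in v multiply to
    the multinomial quotient above.

    For the sum of bivariate polynomials the point is a linearization formula.
    With Q = q^2 and (Q)_n = (1 - Q)...(1 - Q^n),

      w_(m,n)(x,y) = sum_k (-r)^k Q^(k(k-1)/2)
        (Q)_m (Q)_n / ((Q)_k (Q)_(m-k) (Q)_(n-k))
        (b^2/4)^k w_(m-k)(x) w_(n-k)(y),

    valid for every r.  It is proved by induction on m ([w2_expansion]): the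
    three-term recurrence of w_(m-k)(x) produces two terms, one of which
    matches the term in w_(m-1,n) ([w2coef_pred]), while the other is accounted
    for by w_(m+1,n) and the term in w_(m,n-1), through a Pascal-type rule
    ([w2coef_rec]).  Since (Q)_n is a signed power of q times
    (q - q^-1)^n [n]!, the choice r = q^(1-N) makes all powers of q that depend
    on s and t cancel ([qbinom_w2coef]), which leaves the coefficient above.

    The algebra of coefficients may be noncommutative, but only powers of b^2
    and scalars enter, so everything in sight commutes.  Of the base field the
    argument uses that 2 is invertible and that q is nonzero and not a root of
    unity, which makes all q-factorials invertible. *)

(** * Scalar coefficients *)

Section Coefficients.
Set Implicit Arguments.
Unset Strict Implicit.
Variables (F : fieldType) (q : F).
Hypothesis q_neq0 : q != 0.
Hypothesis q_free : forall n, (0 < n)%N -> q ^+ n != 1.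

Local Notation Q := (q ^+ 2).

(** The falling q-factorial prod_(i < k) (1 - Q^(n-i)); writing Q^(n-i) as a
    quotient keeps the factor with i = n when n < k, so that the product
    vanishes there, as the recurrences below need. *)
Definition qfall (n k : nat) : F := \prod_(i < k) (1 - Q ^+ n / Q ^+ i).

Lemma qfallS n k : qfall n k.+1 = qfall n k * (1 - Q ^+ n / Q ^+ k).
Proof. by rewrite /qfall big_ord_recr. Qed.

Lemma qfallSS n k : qfall n.+1 k.+1 = (1 - Q ^+ n.+1) * qfall n k.
Proof.
rewrite /qfall big_ord_recl expr0 divr1; congr (_ * _).
apply: eq_bigr => i _; rewrite lift0 [in LHS]exprS [in LHS](exprS _ i).
by field; rewrite ?expf_neq0.
Qed.

Lemma qfall_small n k : (n < k)%N -> qfall n k = 0.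
Proof.
move=> lt_nk; rewrite /qfall (bigD1 (Ordinal lt_nk)) //=.
by rewrite divff ?expf_neq0 // subrr mul0r.
Qed.

Lemma one_sub_Q_neq0 n : 1 - Q ^+ n.+1 != 0.
Proof. by rewrite subr_eq0 eq_sym -exprM q_free. Qed.

Lemma qfall_diag_neq0 k : qfall k k != 0.
Proof.
elim: k => [|k IH]; first by rewrite /qfall big_ord0 oner_neq0.
by rewrite qfallSS mulf_neq0 ?one_sub_Q_neq0.
Qed.

Lemma q_sub_inv_neq0 : q - q^-1 != 0.
Proof.
have := one_sub_Q_neq0 0; apply: contraNneq => /eqP.
rewrite subr_eq0 => /eqP e; rewrite expr1 expr2 {2}e divff //.
by rewrite subrr.
Qed.

Lemma one_sub_QE n : 1 - Q ^+ n = - q ^+ n * (q - q^-1) * qnum q n.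
Proof.
rewrite /qnum -exprM mulnC exprM expr2.
have := q_sub_inv_neq0; have := expf_neq0 n q_neq0.
set x := q ^+ n; set d := q - q^-1 => x0 d0.
by field; rewrite x0 d0.
Qed.

Lemma qnum_neq0 n : qnum q n.+1 != 0.
Proof.
by have := one_sub_Q_neq0 n; rewrite one_sub_QE mulf_eq0 => /norP[].
Qed.

Lemma qfactS n : qfact q n.+1 = qfact q n * qnum q n.+1.
Proof. by rewrite /qfact big_nat_recr. Qed.

Lemma qfact_neq0 n : qfact q n != 0.
Proof.
elim: n => [|n IH]; first by rewrite /qfact big_geq // oner_neq0.
by rewrite qfactS mulf_neq0 ?qnum_neq0.
Qed.

(** The bridge from Q-products to symmetric q-factorials: 1 - Q^n is
    - q^n (q - q^-1) [n], and the exponents n from s + 1 to s + k add up to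
    'C(k + 1, 2) + s k. *)
Lemma qfall_qfact s k : qfall (s + k) k =
  (- (q - q^-1)) ^+ k * q ^+ ('C(k.+1, 2) + s * k)
  * qfact q (s + k) / qfact q s.
Proof.
elim: k => [|k IH].
  rewrite /qfall big_ord0 addn0 muln0 !expr0 !mul1r divff //.
  exact: qfact_neq0.
rewrite addnS qfallSS IH one_sub_QE qfactS [in RHS]exprS.
have -> : ('C(k.+2, 2) + s * k.+1 = (s + k).+1 + ('C(k.+1, 2) + s * k))%N.
  by rewrite binS bin1; lia.
rewrite (exprD q (s + k).+1); move: (q - q^-1) (qfact_neq0 s) => d f0.
set e := q ^+ (s + k).+1.
by field; rewrite f0.
Qed.

Variable r : F.

Definition signed_qbinom (N n : nat) : F := (-1) ^+ n * qbinom q N n.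

(** Coefficients of the linearization formula; the factor
    (Q)_m / (Q)_(m-k) is [qfall m k]. *)
Definition w2coef (m n k : nat) : F :=
  (- r) ^+ k * Q ^+ 'C(k, 2) * qfall m k * qfall n k / qfall k k.

Lemma w2coef0 m n : w2coef m n 0 = 1.
Proof. by rewrite /w2coef /qfall !big_ord0 !expr0 !mulr1 divr1. Qed.

Lemma w2coef_small m n k : (m < k)%N || (n < k)%N -> w2coef m n k = 0.
Proof.
by rewrite /w2coef; case/orP=> /qfall_small ->; rewrite ?(mulr0, mul0r).
Qed.

(** Both sides contain the product of the k + 1 factors 1 - Q^(m-i), i <= k,
    split off at either end. *)
Lemma w2coef_pred m n k : (k <= m)%N ->
  w2coef m n k * (1 - Q ^+ (m - k)) =
  (1 - Q ^+ m) * w2coef m.-1 n k.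
Proof.
case: m => [|m] lt_km; first by rewrite sub0n subrr mul0r mulr0.
have := qfallS m.+1 k.
rewrite qfallSS -expfB_cond ?expf_eq0 ?(negPf q_neq0) //= /w2coef.
move: (qfall m.+1 k) (1 - _ : F) (qfall m k) (1 - _ : F) (qfall k k)^-1.
move=> x y z t u e.
transitivity ((x * y) * ((- r) ^+ k * Q ^+ 'C(k, 2) * qfall n k * u)).
  by ring.
by rewrite -e; ring.
Qed.

(** Pascal's rule for [qfall]: the products for m and m + 1 share all factors
    but the two extreme ones, and these differ by a multiple of 1 - Q^(k+1),
    which turns [qfall k.+1 k.+1] into [qfall k k]. *)
Lemma w2coef_rec m n k : w2coef m n.+1 k.+1 =
  w2coef m.+1 n.+1 k.+1
  + Q ^+ m * (1 - Q ^+ n.+1) * r * w2coef m n k.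
Proof.
rewrite /w2coef (qfallSS m) (qfallSS n) (qfallSS k) (qfallS m).
rewrite [in X in _ = X + _](exprS _ m) binS bin1 exprD (exprS (- r)).
have := one_sub_Q_neq0 k; rewrite (exprS _ k).
move: (expf_neq0 k (expf_neq0 2 q_neq0)) (qfall_diag_neq0 k).
set u := q ^+ 2; set x := u ^+ k; set y := qfall k k => x0 y0 z0.
by field; rewrite x0 y0 z0.
Qed.

(** The common coefficient of (b^2/4)^k w_s(x) w_t(y) in the three sums. *)
Definition normal_coef (N k s t : nat) : F :=
  (-1) ^+ t * (qfact q N / (qfact q k * qfact q s * qfact q t))
  * ((-1) ^+ k * q ^+ k * ((q - q^-1) ^+ k * q ^- (k * k.+1)./2)).

(** The only place where the value of r matters: r^k supplies
    q^(-k(2k+s+t-1)), which cancels the contributions q^(sk) and q^(tk) of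
    (Q)_(s+k) / (Q)_s and (Q)_(t+k) / (Q)_t. *)
Lemma qbinom_w2coef k s t : r = q ^- (k.*2 + s + t).-1 ->
  let N := (k.*2 + s + t)%N in (0 < N)%N ->
  signed_qbinom N (t + k) * w2coef (s + k) (t + k) k
    = normal_coef N k s t.
Proof.
move=> /[swap] N /[swap] N_gt0 r_def.
rewrite /w2coef /normal_coef /signed_qbinom /qbinom.
have -> : (N - (t + k) = s + k)%N by rewrite /N; lia.
have := qfall_qfact 0 k; rewrite add0n mul0n addn0 => ->.
rewrite !qfall_qfact r_def -/N [qfact q 0]/qfact big_geq // divr1.
(* Once every exponent of q is written through 'C(k, 2), k, s * k and t * k,
   the claim becomes a rational identity in the corresponding powers of q. *)
have eC : ((k * k.+1)./2 = k + 'C(k, 2))%N.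
  by rewrite mulnC -[k in (_ * k)%N]/(k.+1.-1) -bin2 binS bin1 addnC.
have eN : (N.-1 * k = 'C(k, 2) + 'C(k, 2) + 'C(k, 2) + 'C(k, 2)
                      + k + s * k + t * k)%N.
  have : ('C(k, 2).*2 + k = k * k)%N.
    by elim: (k) => // n IH; rewrite binS bin1; nia.
  by rewrite /N; nia.
have -> : (- q ^- N.-1) ^+ k =
    (-1) ^+ k / (q ^+ 'C(k, 2) * q ^+ 'C(k, 2) * q ^+ 'C(k, 2) * q ^+ 'C(k, 2)
                 * q ^+ k * q ^+ (s * k) * q ^+ (t * k)).
  by rewrite (exprNn (q ^- _)) exprVn -(exprM q N.-1) eN !exprD.
have -> : Q ^+ 'C(k, 2) = q ^+ 'C(k, 2) * q ^+ 'C(k, 2).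
  by rewrite -exprM mul2n -addnn exprD.
rewrite eC binS bin1 !exprD (exprNn (q - _)).
(* The two sides differ by an even power of this sign. *)
have sg : (-1) ^+ k * (-1) ^+ k = 1 :> F by rewrite -expr2 sqrr_sign.
rewrite -[RHS]mulr1 -[X in _ = _ * X]sg.
have := qfact_neq0; have : (-1) ^+ k != 0 :> F by rewrite signr_eq0.
move: (expf_neq0 'C(k, 2) q_neq0) (expf_neq0 k q_neq0).
move: (expf_neq0 (s * k) q_neq0) (expf_neq0 (t * k) q_neq0).
move: (expf_neq0 k q_sub_inv_neq0).
set e := (-1) ^+ k; set e' := (-1) ^+ t; set d := (q - _) ^+ k.
set S := q ^+ (s * k); set T := q ^+ (t * k).
set x := q ^+ k; set X := q ^+ 'C(k, 2) => d0 S0 T0 X0 x0 e0 f0.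
by field; rewrite !f0 d0 S0 T0 X0 x0 e0.
Qed.

Definition vcoef (m k : nat) : F :=
  (-1) ^+ k * q ^+ k * (qfact q m / (qfact q (m - k.*2) * qfact q k))
  * ((q - q^-1) ^+ k * q ^- (k * k.+1)./2).

Lemma qbinom_vcoef_x N k s t : N = (k.*2 + s + t)%N ->
  signed_qbinom N t * vcoef (N - t) k = normal_coef N k s t.
Proof.
move=> eN; rewrite /vcoef /normal_coef /signed_qbinom /qbinom.
have -> : (N - t - k.*2 = s)%N by lia.
have f0 := qfact_neq0; have := expf_neq0 (k * k.+1)./2 q_neq0.
set u := q ^+ (k * k.+1)./2; set d := (q - q^-1) ^+ k => u0.
by field; rewrite !f0 u0.
Qed.

Lemma qbinom_vcoef_y N k s t : N = (k.*2 + s + t)%N ->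
  signed_qbinom N (t + k.*2) * vcoef (t + k.*2) k
    = normal_coef N k s t.
Proof.
move=> eN; rewrite /vcoef /normal_coef /signed_qbinom /qbinom addnK.
have -> : (N - (t + k.*2) = s)%N by lia.
have -> : (-1) ^+ (t + k.*2) = (-1) ^+ t :> F.
  by rewrite -signr_odd oddD odd_double addbF signr_odd.
have f0 := qfact_neq0; have := expf_neq0 (k * k.+1)./2 q_neq0.
set u := q ^+ (k * k.+1)./2; set d := (q - q^-1) ^+ k => u0.
by field; rewrite !f0 u0.
Qed.

End Coefficients.

(** * Reindexing double sums *)

Section Reindexing.
Variables (V : nmodType) (N : nat).

Lemma big_nat_shift (f : nat -> V) (i j : nat) :
  \sum_(0 <= n < N.+1 | (j <= n)%N && (n + i <= N)%N) f n =
  \sum_(0 <= t < N.+1 | (t + j + i <= N)%N) f (t + j)%N.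
Proof.
have [lt_Nj|le_jN] := ltnP N j.
  by rewrite big_nat_cond [RHS]big_nat_cond !big_pred0 // => n; lia.
rewrite (@big_cat_nat _ _ _ j) ?leqW //= big_nat_cond big_pred0; last first.
  by move=> n; lia.
rewrite add0r -{1}[j]add0n big_addn (big_nat_widen _ _ N.+1); last by lia.
by apply: eq_bigl => t; lia.
Qed.

(** The three sums are indexed by different pairs: the y-degree n drops to
    t = n - j(k) and the x-degree N - n drops to N - n - i(k), where (j, i) is
    (k, k) for the bivariate polynomials and (2k, 0), (0, 2k) for v(y), v(x). *)
Lemma reindex_triangle (j i : nat -> nat) (f : nat -> nat -> V) :
  \sum_(0 <= n < N.+1)
     \sum_(0 <= k < N.+1 | (j k <= n)%N && (n + i k <= N)%N) f k n =
  \sum_(0 <= k < N.+1) \sum_(0 <= t < N.+1 | (t + j k + i k <= N)%N)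
     f k (t + j k)%N.
Proof.
rewrite (exchange_big_dep_nat xpredT) //=.
by apply: eq_bigr => k _; rewrite big_nat_shift.
Qed.

End Reindexing.

(** * Expansions in products of univariate polynomials *)

Section Expansion.
Set Implicit Arguments.
Unset Strict Implicit.
Variables (F : fieldType) (A : algType F) (b2 : A) (q : F).
Hypothesis q_neq0 : q != 0.
Hypothesis q_free : forall n, (0 < n)%N -> q ^+ n != 1.
Local Notation Q := (q ^+ 2).
Local Notation wx m := ((w b2 q m)^:P).
Local Notation wy n := ((w b2 q n)%:P).

(** c (b^2/4)^k as a constant bivariate polynomial.  Since the polynomials over
    [A] carry no scalar multiplication by [F], scalars are kept in this form
    too, with k = 0. *)
Definition bterm (c : F) (k : nat) : {poly {poly A}} :=
  (c *: (4%:R^-1 *: b2) ^+ k)%:P%:P.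

Lemma btermM c d i j : bterm c i * bterm d j = bterm (c * d) (i + j).
Proof. by rewrite /bterm -!polyCM -scalerAl -scalerAr scalerA exprD. Qed.

Lemma btermD c d i : bterm (c + d) i = bterm c i + bterm d i.
Proof. by rewrite /bterm scalerDl !polyCD. Qed.

Lemma bterm0 i : bterm 0 i = 0.
Proof. by rewrite /bterm scale0r !polyC0. Qed.

Lemma bterm_quarter c : ((c / 4%:R) *: b2)%:P%:P = bterm c 1.
Proof. by rewrite /bterm expr1 scalerA. Qed.

Lemma bterm_comm_w c i m : bterm c i * wx m = wx m * bterm c i.
Proof.
suff cwb : GRing.comm (w b2 q m) (c *: (4%:R^-1 *: b2) ^+ i)%:P.
  have -> : bterm c i = ((c *: (4%:R^-1 *: b2) ^+ i)%:P)^:P.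
    by rewrite map_polyC.
  by rewrite -!rmorphM /= cwb.
apply/polyP => j; rewrite coefMC coefCM coef_bscale.
rewrite exprZn -!scalerAl -!scalerAr !scalerA -!exprD addnC.
by congr (_ *: _); ring.
Qed.

Definition normal_term (N k s t : nat) : {poly {poly A}} :=
  bterm (normal_coef q N k s t) k * (wx s * wy t).

Definition normal_sum (N : nat) : {poly {poly A}} :=
  \sum_(0 <= k < N.+1) \sum_(0 <= t < N.+1 | (t + k.*2 <= N)%N)
    normal_term N k (N - k.*2 - t) t.

Lemma vy_expansion s n : wx s * (v b2 q n)%:P =
  \sum_(0 <= k < n./2.+1)
    bterm (vcoef q n k) k * (wx s * wy (n - k.*2)).
Proof.
rewrite /v rmorph_sum big_distrr /=; apply: eq_bigr => k _.
rewrite /eta scalerA -mul_polyC rmorphM /= -/(bterm _ _) mulrA.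
by rewrite -bterm_comm_w -[LHS]mulrA.
Qed.

Lemma vx_expansion m n : (v b2 q m)^:P * wy n =
  \sum_(0 <= k < m./2.+1)
    bterm (vcoef q m k) k * (wx (m - k.*2) * wy n).
Proof.
rewrite /v rmorph_sum big_distrl /=; apply: eq_bigr => k _.
by rewrite /eta scalerA -mul_polyC rmorphM /= map_polyC -/(bterm _ _)
  -[LHS]mulrA.
Qed.

Lemma sum_wv N :
  \sum_(0 <= n < N.+1) bterm (signed_qbinom q N n) 0
    * (wx (N - n) * (v b2 q n)%:P)
    = normal_sum N.
Proof.
pose f k n := bterm (signed_qbinom q N n) 0
  * (bterm (vcoef q n k) k * (wx (N - n) * wy (n - k.*2))).
rewrite /normal_sum; transitivity
  (\sum_(0 <= n < N.+1)
     \sum_(0 <= k < N.+1 | (k.*2 <= n)%N && (n + 0 <= N)%N) f k n).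
  apply: eq_big_nat => n /andP[_ le_nN].
  rewrite vy_expansion big_distrr /= (big_nat_widen _ _ N.+1) //; last by lia.
  by apply: eq_bigl => k; lia.
rewrite (reindex_triangle N double (fun _ => 0%N)).
apply: eq_bigr => k _; apply: eq_big => [t|t le_N]; first by rewrite addn0.
rewrite /f /normal_term mulrA btermM add0n addnK.
rewrite (_ : N - (t + k.*2) = N - k.*2 - t)%N; last lia.
congr (bterm _ _ * _); set s := (N - k.*2 - t)%N.
have eN : N = (k.*2 + s + t)%N by rewrite /s; lia.
exact: qbinom_vcoef_y.
Qed.

Lemma sum_vw N :
  \sum_(0 <= n < N.+1) bterm (signed_qbinom q N n) 0
    * ((v b2 q (N - n))^:P * wy n)
    = normal_sum N.
Proof.
pose f k n := bterm (signed_qbinom q N n) 0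
  * (bterm (vcoef q (N - n) k) k * (wx (N - n - k.*2) * wy n)).
rewrite /normal_sum; transitivity
  (\sum_(0 <= n < N.+1)
     \sum_(0 <= k < N.+1 | (0 <= n)%N && (n + k.*2 <= N)%N) f k n).
  apply: eq_big_nat => n /andP[_ le_nN].
  rewrite vx_expansion big_distrr /= (big_nat_widen _ _ N.+1) //; last by lia.
  by apply: eq_bigl => k; lia.
rewrite (reindex_triangle N (fun _ => 0%N) double).
apply: eq_bigr => k _; apply: eq_big => [t|t le_N]; first by rewrite addn0.
rewrite addn0 /f /normal_term mulrA btermM add0n (subnAC N t).
congr (bterm _ _ * _); set s := (N - k.*2 - t)%N.
by apply: qbinom_vcoef_x => //; rewrite /s; lia.
Qed.

(** * The linearization formula *)

Hypothesis two_neq0 : 2%:R != 0 :> F.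

(** With the predecessor in place of a case distinction: for m = 0 the last
    coefficient vanishes. *)
Lemma wx_rec m :
  'X * wx m = wx m.+1 + bterm (1 - Q ^+ m) 1 * wx m.-1.
Proof.
have := congr1 (map_poly polyC) (w_rec b2 q two_neq0 m).
rewrite rmorphM rmorphD /= map_polyX -mul_polyC rmorphM /= map_polyC /=.
rewrite exprM bterm_quarter => ->; congr (_ + _).
by case: m => [|m] //=; rewrite expr0 subrr bterm0 !mul0r.
Qed.

Lemma bterm_comm_X c i : 'X * bterm c i = bterm c i * 'X.
Proof. by rewrite [RHS]commr_polyX. Qed.

Variable r : F.

Lemma w2_step m n : w2 b2 q r m.+1 n = 'X * w2 b2 q r m n
  - bterm (1 - Q ^+ m) 1 * w2 b2 q r m.-1 n
  - bterm (Q ^+ m * (1 - Q ^+ n) * r) 1 * w2 b2 q r m n.-1.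
Proof.
rewrite w2_rec // -!mul_polyC !bterm_quarter !exprM.
have <- : bterm (1 - Q ^+ m) 1
      * (if m is m'.+1 then w2 b2 q r m' n else 0)
    = bterm (1 - Q ^+ m) 1 * w2 b2 q r m.-1 n.
  by case: m => //; rewrite expr0 subrr bterm0 !mul0r.
have <- : bterm (Q ^+ m * (1 - Q ^+ n) * r) 1
      * (if n is n'.+1 then w2 b2 q r m n' else 0)
    = bterm (Q ^+ m * (1 - Q ^+ n) * r) 1 * w2 b2 q r m n.-1.
  by case: n => //; rewrite mulr0 expr0 subrr mulr0 mul0r bterm0 mul0r.
by rewrite -[in RHS]addrA -opprD -(addrA (w2 _ _ _ _ _)) addrK.
Qed.

(** The upper bound n is chosen because n is fixed in the induction; terms with
    m < k have coefficient 0, whatever [m - k] means there. *)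
Lemma w2_expansion m n : w2 b2 q r m n =
  \sum_(0 <= k < n.+1) bterm (w2coef q r m n k) k * (wx (m - k) * wy (n - k)).
Proof.
elim/ltn_ind: m n => -[|m] IH n.
  rewrite w2_0 big_nat_recl // big1_seq ?addr0 => [|k _]; last first.
    by rewrite w2coef_small // bterm0 mul0r.
  rewrite w2coef0 !subn0 w_0 rmorph1 mul1r.
  by rewrite /bterm scale1r expr0 mul1r.
rewrite w2_step (IH m) //.
(* The w_(m-1,n) term consists of the lowering parts of 'X * w_(m-k)(x). *)
have -> : bterm (1 - Q ^+ m) 1 * w2 b2 q r m.-1 n =
  \sum_(0 <= k < n.+1) bterm (w2coef q r m n k * (1 - Q ^+ (m - k))) k.+1
    * (wx (m - k).-1 * wy (n - k)).
  case: m IH => [|m] IH.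
    rewrite expr0 subrr bterm0 mul0r big1_seq // => k _.
    by rewrite mulr0 bterm0 mul0r.
  rewrite IH // big_distrr /=; apply: eq_bigr => k _.
  rewrite mulrA btermM add1n; case: (leqP k m.+1) => [le_km|lt_mk].
    by rewrite w2coef_pred // predn_sub.
  by rewrite !w2coef_small ?lt_mk ?(ltnW lt_mk) // mulr0 mul0r bterm0 !mul0r.
rewrite big_distrr /= -sumrB.
have step k : 'X * (bterm (w2coef q r m n k) k * (wx (m - k) * wy (n - k)))
   - bterm (w2coef q r m n k * (1 - Q ^+ (m - k))) k.+1
       * (wx (m - k).-1 * wy (n - k))
  = bterm (w2coef q r m n k) k * (wx (m.+1 - k) * wy (n - k)).
  case: (leqP k m) => [le_km|lt_mk]; last first.
    by rewrite w2coef_small ?lt_mk // mul0r !bterm0 !mul0r mulr0 subrr.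
  rewrite mulrA bterm_comm_X -mulrA (mulrA 'X) wx_rec mulrDl mulrDr.
  rewrite -(mulrA (bterm _ 1)) (mulrA _ (bterm _ 1)) btermM addn1 addrK.
  by rewrite subSn.
rewrite (eq_bigr _ (fun k _ => step k)).
(* What remains is the raising parts, compared by Pascal's rule. *)
case: n step => [|n] step.
  by rewrite expr0 subrr mulr0 mul0r bterm0 mul0r subr0 !big_nat1 !w2coef0.
rewrite IH // big_distrr /= big_nat_recl // [RHS]big_nat_recl // !w2coef0.
rewrite -addrA; congr (_ + _); rewrite -sumrB; apply: eq_bigr => k _.
rewrite mulrA btermM add1n !subSS -mulrBl; congr (_ * _).
by rewrite w2coef_rec // btermD addrK.
Qed.

Lemma sum_w2 N : (0 < N)%N -> r = q ^- N.-1 ->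
  \sum_(0 <= n < N.+1) bterm (signed_qbinom q N n) 0 * w2 b2 q r (N - n) n
    = normal_sum N.
Proof.
move=> N_gt0 r_def.
pose f k n := bterm (signed_qbinom q N n) 0
  * (bterm (w2coef q r (N - n) n k) k
     * (wx (N - n - k) * wy (n - k))).
rewrite /normal_sum; transitivity
  (\sum_(0 <= n < N.+1) \sum_(0 <= k < N.+1 | (k <= n)%N && (n + k <= N)%N)
     f k n).
  apply: eq_big_nat => n /andP[_ le_nN].
  rewrite w2_expansion big_distrr /= (big_nat_widen _ _ N.+1) //.
  rewrite big_mkcond [RHS]big_mkcond /=; apply: eq_bigr => k _.
  rewrite ltnS; case: (leqP k n) => //= le_kn; case: (leqP (n + k) N) => // gtN.
  by rewrite w2coef_small ?bterm0 ?mul0r ?mulr0 //; apply/orP; left; lia.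
rewrite (reindex_triangle N (fun k => k) (fun k => k)).
apply: eq_bigr => k _; apply: eq_big => [t|t]; first by rewrite -addnA addnn.
move=> le_N; rewrite /f /normal_term mulrA btermM add0n addnK.
rewrite (_ : N - (t + k) - k = N - k.*2 - t)%N; last lia.
congr (bterm _ _ * _); set s := (N - k.*2 - t)%N.
have eN : N = (k.*2 + s + t)%N by rewrite /s; lia.
have -> : (N - (t + k) = s + k)%N by lia.
by rewrite {1 2}eN qbinom_w2coef -?eN.
Qed.

End Expansion.

Theorem proposition4p4 (k : fieldType) (char_k : [pchar k] =i pred0)
    (M : algType {fraction {poly k}}) (b2 : M) (b2_neq0 : b2 != 0)
    (a : int) (a_le0 : a <= 0) :
  let q : {fraction {poly k}} := tofrac 'X in
  let r := q ^ a in
  let N := `|(1 - a)%R|%N in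
  let c (n : nat) : {poly {poly M}} :=
    (((-1) ^+ n * qbinom q N n)%:A : M)%:P%:P in
  \sum_(0 <= n < N.+1) c n * w2 b2 q r (N - n) n
    = \sum_(0 <= n < N.+1) c n * ((w b2 q (N - n))^:P * (v b2 q n)%:P)
  /\
  \sum_(0 <= n < N.+1) c n * ((w b2 q (N - n))^:P * (v b2 q n)%:P)
    = \sum_(0 <= n < N.+1) c n * ((v b2 q (N - n))^:P * (w b2 q n)%:P).
Proof.
move=> q r N c.
have q_neq0 : q != 0 by rewrite tofrac_eq0 polyX_eq0.
have q_free n : (0 < n)%N -> q ^+ n != 1.
  move=> n_gt0; rewrite -tofracXn -tofrac1 tofrac_eq.
  apply/eqP => /(congr1 (fun p : {poly k} => size p)).
  by rewrite size_polyXn size_poly1; lia.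
have two_neq0 : 2%:R != 0 :> {fraction {poly k}}.
  rewrite -(rmorph_nat (@tofrac {poly k})) tofrac_eq0 -polyC_natr polyC_eq0.
  by move/pcharf0P: char_k => ->.
have N_gt0 : (0 < N)%N by rewrite /N; lia.
have r_def : r = q ^- N.-1.
  by rewrite /r exprnN; congr (_ ^ _); rewrite /N; lia.
by rewrite (sum_w2 b2 q_neq0 q_free two_neq0 N_gt0 r_def)
  (sum_wv b2 q_neq0 q_free N) (sum_vw b2 q_neq0 q_free N).
Qed.
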